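(* Let $\mathcal A$ be a commutative unital C*-algebra and let $\mathcal M$ be a full Hilbert $\mathcal A$-module. Then each 2-local derivation on $\mathrm{End}_{\mathcal A}(\mathcal M)$ is a derivation.
   Context: C*-algebras are complex. A Hilbert $\mathcal A$-module is a left $\mathcal A$-module $\mathcal M$ with an $\mathcal A$-valued inner product $\langle\cdot,\cdot\rangle:\mathcal M\times\mathcal M\to\mathcal A$ satisfying, for $\lambda\in\mathbb C$, $a\in\mathcal A$, $x,y,z\in\mathcal M$: $\langle x,x\rangle\ge 0$, and $\langle x,x\rangle=0$ implies $x=0$; $\langle\lambda x+y,z\rangle=\lambda\langle x,z\rangle+\langle y,z\rangle$; $\langle ax,y\rangle=a\langle x,y\rangle$; $\langle x,y\rangle=\langle y,x\rangle^*$; and such that $\mathcal M$ is complete for the norm $\|x\|=\|\langle x,x\rangle\|^{1/2}$. $\mathcal M$ is full if the closed linear span of $\{\langle x,y\rangle:x,y\in\mathcal M\}$ equals $\mathcal A$. A linear map $T:\mathcal M\to\mathcal M$ is $\mathcal A$-linear if $T(ax)=aT(x)$ for all $a\in\mathcal A$, $x\in\mathcal M$. $\mathrm{End}_{\mathcal A}(\mathcal M)$ is the Banach algebra (operator norm, composition) of all bounded $\mathcal A$-linear maps $\mathcal M\to\mathcal M$. A derivation on an algebra $\mathcal B$ is a ($\mathbb C$-)linear map $d:\mathcal B\to\mathcal B$ with $d(xy)=d(x)y+xd(y)$ for all $x,y\in\mathcal B$. A 2-local derivation on $\mathcal B$ is a map $\delta:\mathcal B\to\mathcal B$ (not necessarily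 linear) such that for each $a,b\in\mathcal B$ there is a derivation $d_{a,b}:\mathcal B\to\mathcal B$ with $\delta(a)=d_{a,b}(a)$ and $\delta(b)=d_{a,b}(b)$. *)

(* Defs.v *)
From HB Require Import structures.
From mathcomp Require Import all_boot all_order all_algebra.
From mathcomp Require Import complex.
From mathcomp Require Import all_classical all_reals all_analysis.

Set Implicit Arguments.
Unset Strict Implicit.
Unset Printing Implicit Defensive.

Import Order.TTheory GRing.Theory Num.Theory.
Import numFieldNormedType.Exports.

Local Open Scope classical_set_scope.
Local Open Scope ring_scope.

(* The product of the algebra B is a separate argument: the algebra types of
   the library require 1 != 0, which fails for End_A(M) when M is zero. *)
Section Derivations.
Context {K : pzRingType} {B : lmodType K} (mul : B -> B -> B).

Definition is_derivation (d : B -> B) : Prop :=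
  linear d /\ forall x y : B, d (mul x y) = mul (d x) y + mul x (d y).

Definition is_2local_derivation (delta : B -> B) : Prop :=
  forall a b : B, exists d : B -> B,
    [/\ is_derivation d, delta a = d a & delta b = d b].

End Derivations.

(* The ring operations are fields of the mixin, and the PzRing instance is
   derived below, because the hierarchy has no join of a ring and a normed
   space other than numDomainType.  The zero algebra is allowed. *)
HB.mixin Record isCStarAlgebra (R : realType) A
    of CompleteNormedModule R[i] A := {
  cone : A;
  cmul : A -> A -> A;
  cmulA : associative cmul;
  cmul1r : left_id cone cmul;
  cmulr1 : right_id cone cmul;
  cmulDl : left_distributive cmul +%R;
  cmulDr : right_distributive cmul +%R;
  cscalerAl : forall (k : R[i]) (a b : A), k *: cmul a b = cmul (k *: a) b;
  cscalerAr : forall (k : R[i]) (a b : A), k *: cmul a b = cmul a (k *: b);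
  star : A -> A;
  starK : involutive star;
  starD : forall a b : A, star (a + b) = star a + star b;
  starZ : forall (k : R[i]) (a : A), star (k *: a) = k^* *: star a;
  starM : forall a b : A, star (cmul a b) = cmul (star b) (star a);
  cstar_normM : forall a b : A, `|cmul a b| <= `|a| * `|b|;
  cstar_identity : forall a : A, `|cmul (star a) a| = `|a| ^+ 2
}.

#[short(type="cstarAlgType")]
HB.structure Definition CStarAlgebra (R : realType) :=
  {A of CompleteNormedModule R[i] A & isCStarAlgebra R A}.

HB.instance Definition _ (R : realType) (A : cstarAlgType R) :=
  GRing.Zmodule_isPzRing.Build (CStarAlgebra.sort A)
    cmulA cmul1r cmulr1 cmulDl cmulDr.

Section Positivity.
Context {R : realType} {A : cstarAlgType R}.

Definition invertible (a : A) : Prop := exists b : A, a * b = 1 /\ b * a = 1.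

Definition spectrum (a : A) : set R[i] :=
  [set k | ~ invertible (a - k *: (1 : A))].

(* In R[i], 0 <= k means that k is real and nonnegative. *)
Definition cstar_nneg (a : A) : Prop :=
  star a = a /\ forall k, spectrum a k -> 0 <= k.

End Positivity.

(* The A-action is a separate operation because M already carries a scaling
   by R[i].  The norm of M is that of the underlying Banach space, and
   hilb_normE identifies it with the one induced by the inner product. *)
HB.mixin Record isHilbertModule (R : realType) (A : cstarAlgType R) M
    of CompleteNormedModule R[i] M := {
  act : A -> M -> M;
  inner : M -> M -> A;
  act1 : forall x : M, act 1 x = x;
  actM : forall (a b : A) (x : M), act (a * b) x = act a (act b x);
  actDl : forall (a b : A) (x : M), act (a + b) x = act a x + act b x;
  actDr : forall (a : A) (x y : M), act a (x + y) = act a x + act a y;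
  actZl : forall (k : R[i]) (a : A) (x : M), act (k *: a) x = k *: act a x;
  actZr : forall (k : R[i]) (a : A) (x : M), act a (k *: x) = k *: act a x;
  inner_ge0 : forall x : M, cstar_nneg (inner x x);
  inner_eq0 : forall x : M, inner x x = 0 -> x = 0;
  inner_linl : forall (k : R[i]) (x y z : M),
    inner (k *: x + y) z = k *: inner x z + inner y z;
  inner_actl : forall (a : A) (x y : M), inner (act a x) y = a * inner x y;
  inner_star : forall x y : M, inner x y = star (inner y x);
  hilb_normE : forall x : M, `|x| = sqrtC `|inner x x|
}.

#[short(type="hilbertModType")]
HB.structure Definition HilbertModule (R : realType) (A : cstarAlgType R) :=
  {M of CompleteNormedModule R[i] M & isHilbertModule R A M}.

Section HilbertModuleTheory.
Context {R : realType} {A : cstarAlgType R} (M : hilbertModType A).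

Definition inner_span : set A :=
  [set a | exists (n : nat) (k : 'I_n -> R[i]) (x y : 'I_n -> M),
     a = \sum_(i < n) k i *: inner (x i) (y i)].

Definition full : Prop := closure inner_span = [set: A].

Definition is_endA (T : M -> M) : Prop :=
  [/\ linear T,
      forall (a : A) (x : M), T (act a x) = act a (T x) &
      exists C : R[i], forall x : M, `|T x| <= C * `|x| ].

Definition endA_pred : {pred M -> M} := fun T => `[< is_endA T >].

Record endA := EndA { endA_val :> M -> M; endA_valP : endA_pred endA_val }.

HB.instance Definition _ := [isSub for endA_val].
HB.instance Definition _ := [Choice of endA by <:].

Lemma endA_predP T : reflect (is_endA T) (T \in endA_pred).
Proof. exact: asboolP. Qed.

Lemma endAP (T : endA) : is_endA T.
Proof. exact/asboolP/endA_valP. Qed.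

Lemma endA_inj (S T : endA) : (forall x, S x = T x) -> S = T.
Proof. by move=> ST; apply: val_inj; apply/funext. Qed.

Lemma act0 (a : A) : act a (0 : M) = 0.
Proof. by apply: (addrI (act a 0)); rewrite -actDr !addr0. Qed.

Lemma endA_submod_closed : submod_closed endA_pred.
Proof.
split=> [|k S T /endA_predP[Sl Sa [C SC]] /endA_predP[Tl Ta [D TD]]].
  apply/endA_predP; split=> [k x y|a x|]; first by rewrite scaler0 addr0.
    by rewrite act0.
  by exists 0 => x; rewrite normr0 mul0r.
apply/endA_predP; split=> [c x y|a x|].
- rewrite !fctE Sl Tl !scalerDr !scalerA [k * c]mulrC -!scalerA.
  by rewrite -!addrA; congr (_ + _); rewrite addrCA.
- by rewrite !fctE Sa Ta actDr actZr.
exists (`|k| * C + D) => x; rewrite !fctE mulrDl.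
apply: (le_trans (ler_normD _ _)); apply: lerD; last exact: TD.
by rewrite normrZ -mulrA; apply: ler_wpM2l.
Qed.

HB.instance Definition _ :=
  GRing.isSubmodClosed.Build R[i] (M -> M) endA_pred endA_submod_closed.
HB.instance Definition _ := [SubChoice_isSubLmodule of endA by <:].

Lemma is_endA_id : endA_pred idfun.
Proof. by apply/asboolP; split=> //; exists 1 => x; rewrite mul1r. Qed.

Lemma is_endA_comp (S T : endA) : endA_pred (S \o T).
Proof.
have [Sl Sa [C SC]] := endAP S; have [Tl Ta [D TD]] := endAP T.
rewrite /endA_pred; apply/asboolP.
split=> [c x y|a x|] /=; [by rewrite Tl Sl|by rewrite Ta Sa|].
exists (`|C| * D) => x /=; rewrite -mulrA.
have Cn y : `|S y| <= `|C| * `|y|.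
  have Cy : 0 <= C * `|y| := le_trans (normr_ge0 _) (SC y).
  by apply: (le_trans (SC y)); rewrite -[leLHS](ger0_norm Cy) normrM normr_id.
by apply: (le_trans (Cn _)); apply: ler_wpM2l.
Qed.

Definition endA_one : endA := EndA is_endA_id.
Definition endA_mul (S T : endA) : endA := EndA (is_endA_comp S T).

Lemma endA_mulA : associative endA_mul.
Proof. by move=> S T U; apply: endA_inj. Qed.

Lemma endA_mul1 : left_id endA_one endA_mul.
Proof. by move=> S; apply: endA_inj. Qed.

Lemma endA_mulr1 : right_id endA_one endA_mul.
Proof. by move=> S; apply: endA_inj. Qed.

Lemma endA_mulDl : left_distributive endA_mul +%R.
Proof. by move=> S T U; apply: endA_inj. Qed.

Lemma endA_mulDr : right_distributive endA_mul +%R.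
Proof.
move=> S T U; apply: endA_inj => x /=.
by have [Sl _ _] := endAP S; have := Sl 1 (T x) (U x); rewrite !scale1r.
Qed.

HB.instance Definition _ := GRing.Zmodule_isPzRing.Build endA
  endA_mulA endA_mul1 endA_mulr1 endA_mulDl endA_mulDr.

Lemma endA_scalerAl (k : R[i]) (S T : endA) : k *: (S * T) = (k *: S) * T.
Proof. exact: endA_inj. Qed.

Lemma endA_scalerAr (k : R[i]) (S T : endA) : k *: (S * T) = S * (k *: T).
Proof.
apply: endA_inj => x; have [Sl _ _] := endAP S.
have S0 : S 0 = 0.
  by have := Sl (-1) 0 0; rewrite scaler0 addr0 scaleN1r addNr.
by have := Sl k (T x) 0; rewrite S0 !addr0.
Qed.

End HilbertModuleTheory.

(* Main.v *)
(* A derivation [D] of a commutative unital C*-algebra vanishes: modulo a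
   maximal ideal [m] a self-adjoint [h] is congruent to a real scalar [l], and
   for a suitable multiple [k] of [h - l] the element [k^2 + i k] is the square
   of an element of [m], so that [D k], hence [D h], lies in [m]; an element of
   all maximal ideals is zero.

   On [End_A(M)] a derivation therefore kills the center, which is [A] because
   [M] is full.  For a rank one operator [p = <., y> x] one has
   [p T p = <T x, y> p]; applying a derivation, [p (delta T) p] is additive in
   [T] for a 2-local derivation [delta], and hence [delta] is additive.  Now
   [delta] is an [A]-linear Jordan derivation.  By Herstein's identity the
   defect [U = delta (S T) - (delta S) T - S (delta T)] satisfies
   [U r C + C r U = 0] for [C = S T - T S], which forces [<U x, w> C = 0].  Then
   [<U x, w> S] commutes with [T], and for commuting operators the Leibniz rule
   follows from the Jordan identity, so [<U x, w> U = 0] and [U = 0]. *)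
Require Import Defs.
From HB Require Import structures.
From mathcomp Require Import all_boot all_order all_algebra ring lra.
From mathcomp Require Import complex.
From mathcomp Require Import all_classical all_reals all_analysis.
From Stdlib Require Ncring Ncring_tac.

Set Implicit Arguments.
Unset Strict Implicit.
Unset Printing Implicit Defensive.
Import Order.TTheory GRing.Theory Num.Theory.
Import numFieldNormedType.Exports.
Local Open Scope classical_set_scope.
Local Open Scope ring_scope.

(** * Real-valued norms *)

Section RealNorm.
Context {R : realType} {V : normedModType R[i]}.
Implicit Types u v : V.

Definition rnorm (v : V) : R := complex.Re `|v|.

Lemma rnormE v : `|v| = (rnorm v)%:C%C.
Proof. by rewrite /rnorm RRe_real // normr_real. Qed.

Lemma rnorm_ge0 v : 0 <= rnorm v.
Proof. by rewrite -lecR -rnormE normr_ge0. Qed.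

Lemma rnorm0_eq0 v : rnorm v = 0 -> v = 0.
Proof. by move=> v0; apply/normr0_eq0; rewrite rnormE v0. Qed.

Lemma rnorm0 : rnorm (0 : V) = 0.
Proof. by rewrite /rnorm normr0. Qed.

Lemma rnormN v : rnorm (- v) = rnorm v.
Proof. by rewrite /rnorm normrN. Qed.

Lemma rnormD u v : rnorm (u + v) <= rnorm u + rnorm v.
Proof. by rewrite -lecR rmorphD /= -!rnormE ler_normD. Qed.

Lemma rnormZ (k : R) v : rnorm (k%:C%C *: v) = `|k| * rnorm v.
Proof.
apply: complexI; rewrite -rnormE normrZ rmorphM /= -rnormE normc_def /=.
by rewrite expr0n /= addr0 sqrtr_sqr.
Qed.

Lemma rnormZi v : rnorm ('i%C *: v) = rnorm v.
Proof.
apply: complexI; rewrite -!rnormE normrZ normc_def /=.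
by rewrite expr0n expr1n add0r sqrtr1 mul1r.
Qed.

End RealNorm.

(** Increments telescope against those of [t], which approaches its supremum, so [v] is Cauchy. This
    covers any iteration dominated by a bounded scalar one, even without a geometric rate. *)
Lemma rnorm_complete (R : realType) (V : completeNormedModType R[i])
    (v : nat -> V) (t : nat -> R) (C : R) :
  (forall k, rnorm (v k.+1 - v k) <= t k.+1 - t k) ->
  (forall k, t k <= C) ->
  exists l, forall e, 0 < e ->
    exists N, forall k, (N <= k)%N -> rnorm (v k - l) < e.
Proof.
move=> vt tC.
have vtD m k : rnorm (v (m + k)%N - v m) <= t (m + k)%N - t m.
  elim: k => [|k IH]; first by rewrite addn0 !subrr rnorm0.
  rewrite addnS -[_ - v m](subrKA (v (m + k)%N)).
  apply: (le_trans (rnormD _ _)).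
  by rewrite -[t _ - t m](subrKA (t (m + k)%N)) lerD.
have supt : has_sup (range t).
  by split; [exists (t 0%N), 0%N|exists C => _ [k _ <-]].
have small e : 0 < e -> exists N, forall k, (N <= k)%N -> rnorm (v k - v N) < e.
  move=> e0; have [_ [N _ <-] tN] := sup_adherent e0 supt.
  exists N => k Nk; rewrite -(subnKC Nk); apply: (le_lt_trans (vtD _ _)).
  have : t (N + (k - N))%N <= sup (range t).
    by apply: sup_upper_bound => //; exists (N + (k - N))%N.
  move: tN; lra.
have : cauchy (v @ \oo).
  apply: cauchy_exP => e e0.
  have eR : e = (complex.Re e)%:C%C by rewrite RRe_real // gtr0_real.
  have [|N Nv] := small (complex.Re e); first by rewrite -ltcR -eR.
  exists (v N), N => // k /= Nk.
  rewrite /= -ball_normE /ball_ /= distrC rnormE eR ltcR.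
  exact: Nv.
move=> /cauchy_cvg /cvg_ex[l vl]; exists l => e e0.
have e0C : 0 < e%:C%C by rewrite ltcR.
have /cvgrPdist_lt /(_ _ e0C) [N _ Nv] := vl.
exists N => k Nk; rewrite -ltcR -rnormE distrC; exact: Nv.
Qed.

(** * Commutative C*-algebras *)

Section CStar.
Context {R : realType} {A : cstarAlgType R}.
Implicit Types a b : A.

Lemma scale_mulAl (k : R[i]) a b : k *: (a * b) = (k *: a) * b.
Proof. exact: cscalerAl. Qed.

Lemma scale_mulAr (k : R[i]) a b : k *: (a * b) = a * (k *: b).
Proof. exact: cscalerAr. Qed.

Lemma star_mul a b : star (a * b) = star b * star a.
Proof. exact: starM. Qed.

Lemma starN a : star (- a) = - star a.
Proof. by rewrite -scaleN1r starZ rmorphN1 scaleN1r. Qed.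

Lemma star1 : star (1 : A) = 1.
Proof. by rewrite -[LHS]mulr1 -{2}[1]starK -star_mul mulr1 starK. Qed.

Lemma rnormM a b : rnorm (a * b) <= rnorm a * rnorm b.
Proof. by rewrite -lecR rmorphM /= -!rnormE; exact: cstar_normM. Qed.

Lemma rnorm_starM a : rnorm (star a * a) = rnorm a ^+ 2.
Proof.
by apply: complexI; rewrite -rnormE rmorphXn /= -rnormE; exact: cstar_identity.
Qed.

(** The C*-identity gives [|b|^2 = |star b * b| <= |star b| |b|], and [star] is an involution. *)
Lemma rnorm_star a : rnorm (star a) = rnorm a.
Proof.
have le_star b : rnorm b <= rnorm (star b).
  have := rnormM (star b) b; rewrite rnorm_starM expr2.
  have [b0|] := eqVneq (rnorm b) 0; first by rewrite b0 rnorm_ge0.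
  by move=> b0; rewrite ler_pM2r // lt_neqAle rnorm_ge0 eq_sym b0.
by apply/eqP; rewrite eq_le le_star andbT -{2}[a]starK le_star.
Qed.

(** Scalars become elements of the ring, so that scaling is a product and ring tactics apply. *)
Definition scal (k : R[i]) : A := k *: (1 : A).

Lemma scal_additive : additive scal.
Proof. by move=> k l; rewrite /scal scalerBl. Qed.

Lemma scal_monoid : monoid_morphism scal.
Proof.
by split=> [|k l]; rewrite /scal ?scale1r // -scale_mulAl mul1r scalerA.
Qed.

HB.instance Definition _ :=
  GRing.isZmodMorphism.Build R[i] A scal scal_additive.
HB.instance Definition _ :=
  GRing.isMonoidMorphism.Build R[i] A scal scal_monoid.

Lemma scalE (k : R[i]) a : k *: a = scal k * a.
Proof. by rewrite /scal -scale_mulAl mul1r. Qed.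

Definition rscal (r : R) : A := scal r%:C%C.

Lemma rscal_additive : additive rscal.
Proof. by move=> r s; rewrite /rscal !rmorphB. Qed.

Lemma rscal_monoid : monoid_morphism rscal.
Proof. by split=> [|r s]; rewrite /rscal ?rmorph1 ?rmorphM. Qed.

HB.instance Definition _ := GRing.isZmodMorphism.Build R A rscal rscal_additive.
HB.instance Definition _ := GRing.isMonoidMorphism.Build R A rscal rscal_monoid.

Lemma star_rscal r : star (rscal r) = rscal r.
Proof.
rewrite /rscal /scal starZ star1; congr (_ *: _).
by apply: conj_Creal; rewrite realE -(rmorph0 (real_complex R)) !lecR le_total.
Qed.

Lemma rnorm_rscalM r a : rnorm (rscal r * a) = `|r| * rnorm a.
Proof. by rewrite -scalE rnormZ. Qed.

Definition ii : A := scal 'i%C.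

Lemma iiE : ii * ii = -1.
Proof. by rewrite /ii -rmorphM -expr2 sqr_i rmorphN1. Qed.

Lemma star_ii : star ii = - ii.
Proof.
rewrite /ii /scal starZ star1 -scaleNr; congr (_ *: _).
by apply/eqP; rewrite eq_complex /= oppr0 !eqxx.
Qed.

Lemma rnorm_iiM a : rnorm (ii * a) = rnorm a.
Proof. by rewrite -scalE rnormZi. Qed.

End CStar.

(* A commutative C*-algebra with its complex scalars split into a morphism from
   the reals and a square root of [-1], and with a real-valued norm. *)
HB.mixin Record isComCStar (R : realType) A of GRing.ComPzRing A := {
  re : {rmorphism R -> A};
  im : A;
  adj : A -> A;
  nrm : A -> R;
  imE : im * im = -1;
  adjK : involutive adj;
  adjD : forall a b : A, adj (a + b) = adj a + adj b;
  adjM : forall a b : A, adj (a * b) = adj b * adj a;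
  adj_re : forall r, adj (re r) = re r;
  adj_im : adj im = - im;
  nrm0_eq0 : forall a, nrm a = 0 -> a = 0;
  nrm_ge0 : forall a, 0 <= nrm a;
  nrmD : forall a b : A, nrm (a + b) <= nrm a + nrm b;
  nrmM : forall a b : A, nrm (a * b) <= nrm a * nrm b;
  nrm_reM : forall r (a : A), nrm (re r * a) = `|r| * nrm a;
  nrm_imM : forall a : A, nrm (im * a) = nrm a;
  nrm_adj : forall a : A, nrm (adj a) = nrm a;
  nrm_adjM : forall a : A, nrm (adj a * a) = nrm a ^+ 2;
  nrm_complete : forall (v : nat -> A) (t : nat -> R) (C : R),
    (forall k, nrm (v k.+1 - v k) <= t k.+1 - t k) -> (forall k, t k <= C) ->
    exists l, forall e, 0 < e ->
      exists N, forall k, (N <= k)%N -> nrm (v k - l) < e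
}.

#[short(type="comCStarType")]
HB.structure Definition ComCStar (R : realType) :=
  {A of GRing.ComPzRing A & isComCStar R A}.

Section CommAlg.
Context {R : realType} {A : cstarAlgType R}.

(* An alias of [A], because commutativity is only a hypothesis on [A] and so
   cannot provide an instance on [A] itself. *)
Definition comm_alg (hA : commutative (@GRing.mul A)) : Type := A.

Variable hA : commutative (@GRing.mul A).
HB.instance Definition _ := CStarAlgebra.copy (comm_alg hA) A.
HB.instance Definition _ := GRing.PzRing.copy (comm_alg hA) A.
HB.instance Definition _ :=
  GRing.PzRing_hasCommutativeMul.Build (comm_alg hA) hA.
HB.instance Definition _ := @isComCStar.Build R (comm_alg hA)
  (@rscal R A : {rmorphism R -> A}) ii star rnorm iiE starK starD
  star_mul star_rscal star_ii rnorm0_eq0 rnorm_ge0 rnormD rnormM rnorm_rscalM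
  rnorm_iiM rnorm_star rnorm_starM (@rnorm_complete R A).

End CommAlg.

Section ComCStarTheory.
Context {R : realType} {A : comCStarType R}.
Implicit Types a b c h q u v w x y z : A.
Local Notation re := (@re R A).
Local Notation im := (@im R A).

Lemma adj0 : adj 0 = 0 :> A.
Proof. by have := adj_re (s := A) 0; rewrite rmorph0. Qed.

Lemma adj1 : adj 1 = 1 :> A.
Proof. by have := adj_re (s := A) 1; rewrite rmorph1. Qed.

Lemma adjN a : adj (- a) = - adj a.
Proof. by apply/eqP; rewrite -subr_eq0 opprK -adjD addNr adj0. Qed.

Lemma nrmN a : nrm (- a) = nrm a.
Proof. by have := nrm_reM (-1) a; rewrite rmorphN1 mulN1r normrN1 mul1r. Qed.

Lemma nrm0 : nrm (0 : A) = 0.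
Proof. by have := nrm_reM 0 (0 : A); rewrite mulr0 normr0 mul0r. Qed.

(** The C*-identity makes [nrm 1] idempotent; its value is [0] in the zero algebra. *)
Lemma nrm1_le1 : nrm (1 : A) <= 1.
Proof.
have := nrm_adjM (1 : A); rewrite adj1 mulr1 expr2 => n1.
have := nrm_ge0 (1 : A); nra.
Qed.

Lemma nrm_re r : nrm (re r) <= `|r|.
Proof. by rewrite -[re r]mulr1 nrm_reM ler_piMr ?nrm1_le1. Qed.

End ComCStarTheory.

(** * Square roots and inverses by dominated iteration *)

Section SquareRootAndInverse.
Context {R : realType} {A : comCStarType R}.
Implicit Types a b c h q u v w x y z : A.
Local Notation re := (@re R A).
Local Notation im := (@im R A).

Lemma nrm_eq0P (C : R) a :
  (forall e, 0 < e -> nrm a <= C * e) -> a = 0.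
Proof.
move=> aC; apply: nrm0_eq0; apply/eqP; rewrite eq_le nrm_ge0 andbT.
apply/ler_addgt0Pr => e e0; rewrite add0r.
have C0 : 0 < `|C| + 1 by apply: ltr_wpDl.
apply: (le_trans (aC (e / (`|C| + 1)) _)); first by apply: divr_gt0.
rewrite mulrA ler_pdivrMr // mulrC ler_pM2l //.
by apply: (le_trans (ler_norm _)); rewrite lerDl.
Qed.

Lemma re_half : re 2^-1 * 2 = 1 :> A.
Proof. by rewrite -(rmorph_nat re) -rmorphM mulVf ?rmorph1. Qed.

(* With [1 - x = (1 - y)^2] rewritten as [y = (x + y^2) / 2], the iterates from
   [0] are dominated by those of the scalar equation [t = (1 + t^2) / 2], which
   increase and are bounded by [1], even when [nrm x = 1]. *)
Lemma sqrt_near1 x : nrm x <= 1 ->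
  exists y, [/\ nrm y <= 1, (1 - y) * (1 - y) = 1 - x &
                adj x = x -> adj y = y].
Proof.
move=> x1.
pose Y k := iter k (fun y => re 2^-1 * (x + y * y)) 0.
pose T k : R := iter k (fun t => 2^-1 * (1 + t * t)) 0.
have T01 k : 0 <= T k <= 1.
  by elim: k => [|k /andP[T0 T1]]; rewrite /= ?lexx ?ler01 //; nra.
have YT k : nrm (Y k) <= T k.
  elim: k => [|k IH]; first by rewrite nrm0.
  rewrite /= nrm_reM gtr0_norm ?invr_gt0 ?ltr0n // ler_pM2l ?invr_gt0 //.
  apply: (le_trans (nrmD _ _)); apply: lerD => //.
  by apply: (le_trans (nrmM _ _)); apply: ler_pM; rewrite ?nrm_ge0.
have dYT k : nrm (Y k.+1 - Y k) <= T k.+1 - T k.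
  elim: k => [|k IH].
    rewrite /= !mul0r !addr0 !subr0 nrm_reM mulr1.
    by rewrite gtr0_norm ?invr_gt0 ?ltr0n // ger_pMr ?invr_gt0.
  have -> : Y k.+2 - Y k.+1 =
      re 2^-1 * ((Y k.+1 - Y k) * (Y k.+1 + Y k)).
    by rewrite /=; ring.
  have -> : T k.+2 - T k.+1 = 2^-1 * ((T k.+1 - T k) * (T k.+1 + T k)).
    by rewrite /=; ring.
  rewrite nrm_reM gtr0_norm ?invr_gt0 ?ltr0n // ler_pM2l ?invr_gt0 //.
  apply: (le_trans (nrmM _ _)); apply: ler_pM; rewrite ?nrm_ge0 //.
  by apply: (le_trans (nrmD _ _)); apply: lerD.
have [y yY] := nrm_complete _ _ _ dYT (fun k => proj2 (andP (T01 k))).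
have y1 : nrm y <= 1.
  apply/ler_addgt0Pr => e e0; have [N /(_ _ (leqnn N)) YN] := yY _ e0.
  rewrite -[y](subKr (Y N)); apply: (le_trans (nrmD _ _)); rewrite nrmN.
  by apply: lerD; [apply: (le_trans (YT N)); case/andP: (T01 N)|exact: ltW].
exists y; split=> //.
  (* Passage to the limit in the recursion: [Y N] and [Y N.+1] are within [e] of [y], and
     [nrm (Y N + y) <= 2]. *)
  have yfix : y - re 2^-1 * (x + y * y) = 0.
    apply: (@nrm_eq0P 2) => e e0; have [N YN] := yY _ e0.
    have -> : y - re 2^-1 * (x + y * y) =
       - (Y N.+1 - y) + re 2^-1 * ((Y N - y) * (Y N + y)).
      by rewrite /=; ring.
    apply: (le_trans (nrmD _ _)); rewrite nrmN nrm_reM.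
    rewrite gtr0_norm ?invr_gt0 ?ltr0n //.
    have := YN _ (leqnSn N); have := YN _ (leqnn N).
    have := nrmM (Y N - y) (Y N + y); have := nrmD (Y N) y.
    have := YT N; have /andP[_] := T01 N.
    have := nrm_ge0 (Y N - y); have := nrm_ge0 (Y N + y).
    set p := nrm (Y N - y); set q := nrm (Y N + y).
    set r := nrm ((Y N - y) * (Y N + y)).
    by move=> *; nra.
  have -> : x = 2 * y - y * y - 2 * (y - re 2^-1 * (x + y * y)) +
      (1 - re 2^-1 * 2) * (x + y * y).
    by ring.
  by rewrite yfix re_half; ring.
move=> sx; have sY k : adj (Y k) = Y k.
  by elim: k => [|k IH] /=;
    rewrite ?adj0 // adjM adjD adjM sx IH adj_re mulrC.
apply/subr0_eq/(@nrm_eq0P 2) => e e0.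
have [N /(_ _ (leqnn N)) YN] := yY _ e0.
have -> : adj y - y = (Y N - y) - adj (Y N - y).
  by rewrite adjD adjN sY; ring.
apply: (le_trans (nrmD _ _)); rewrite nrmN nrm_adj; lra.
Qed.

(** The partial sums of the geometric series are iterates of [v |-> 1 + q v], dominated by the real
    ones for [nrm q]. *)
Lemma neumann q : nrm q < 1 -> exists v, (1 - q) * v = 1 :> A.
Proof.
move=> q1; have q0 := nrm_ge0 q.
pose V k := iter k (fun v => 1 + q * v) 0.
pose T k : R := iter k (fun t => 1 + nrm q * t) 0.
have dVT k : nrm (V k.+1 - V k) <= T k.+1 - T k.
  elim: k => [|k IH]; first by rewrite /= !mulr0 !addr0 !subr0 nrm1_le1.
  have -> : V k.+2 - V k.+1 = q * (V k.+1 - V k) by rewrite /=; ring.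
  have -> : T k.+2 - T k.+1 = nrm q * (T k.+1 - T k) by rewrite /=; ring.
  by apply: (le_trans (nrmM _ _)); apply: ler_wpM2l.
have TC k : T k <= (1 - nrm q)^-1.
  rewrite -[leRHS]div1r ler_pdivlMr ?subr_gt0 //.
  by elim: k => [|k IH] /=; rewrite ?mul0r ?ler01 //; nra.
have [v vV] := nrm_complete _ _ _ dVT TC.
exists v; apply/subr0_eq/(@nrm_eq0P 2) => e e0; have [N VN] := vV _ e0.
have -> : (1 - q) * v - 1 = - (V N.+1 - v) + q * (V N - v) by rewrite /=; ring.
apply: (le_trans (nrmD _ _)); rewrite nrmN.
have := VN _ (leqnSn N); have := VN _ (leqnn N).
have := nrmM q (V N - v); have := nrm_ge0 (V N - v).
by move=> *; nra.
Qed.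

End SquareRootAndInverse.

(** * Positive elements *)

Section Positivity.
Context {R : realType} {A : comCStarType R}.
Implicit Types a b c h q u v w x y z : A.
Local Notation re := (@re R A).
Local Notation im := (@im R A).

(** For self-adjoint [a] the bound says that the spectrum lies in [[0, 2 t]]. Put as a norm
    condition, it is easily added up and feeds [sqrt_near1]. *)
Definition pos a := adj a = a /\ exists2 t : R, 0 <= t & nrm (re t - a) <= t.

Lemma reV (r : R) : r != 0 -> re r * re r^-1 = 1 :> A.
Proof. by move=> r0; rewrite -rmorphM mulfV ?rmorph1. Qed.

Lemma pos_re (r : R) : 0 <= r -> pos (re r).
Proof.
by move=> r0; split; [exact: adj_re|exists r; rewrite // subrr nrm0].
Qed.

Lemma posD a b : pos a -> pos b -> pos (a + b).
Proof.
move=> [sa [t t0 ta]] [sb [s s0 hs]]; split; first by rewrite adjD sa sb.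
exists (t + s); first exact: addr_ge0.
have -> : re (t + s) - (a + b) = (re t - a) + (re s - b) by ring.
by apply: (le_trans (nrmD _ _)); apply: lerD.
Qed.

Lemma posZ (r : R) a : 0 <= r -> pos a -> pos (re r * a).
Proof.
move=> r0 [sa [t t0 ta]]; split; first by rewrite adjM adj_re sa mulrC.
exists (r * t); first exact: mulr_ge0.
have -> : re (r * t) - re r * a = re r * (re t - a) by ring.
by rewrite nrm_reM ger0_norm // ler_wpM2l.
Qed.

(** For [t > 0], write [a = t (1 - x)] with [nrm x <= 1]; the root is [sqrt t (1 - y)], where
    [(1 - y)^2 = 1 - x]. *)
Lemma pos_sqrt a : pos a -> exists2 b, pos b & b * b = a.
Proof.
move=> [sa [t]]; rewrite le_eqVlt => /orP[/eqP<-|t0 ta].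
  rewrite rmorph0 sub0r nrmN => a0; exists 0.
    by have := pos_re (lexx 0); rewrite rmorph0.
  by rewrite mulr0; apply/esym/nrm0_eq0/le_anti; rewrite a0 nrm_ge0.
have tn0 : t != 0 by rewrite gt_eqF.
have [|y [y1 yE ys]] := @sqrt_near1 _ _ (re t^-1 * (re t - a)).
  by rewrite nrm_reM gtr0_norm ?invr_gt0 // ler_pdivrMl // mulr1.
have {}ys : adj y = y.
  by apply: ys; rewrite adjM adjD adjN !adj_re sa mulrC.
exists (re (Num.sqrt t) * (1 - y)).
  split; first by rewrite adjM adjD adjN adj1 adj_re ys mulrC.
  exists (Num.sqrt t); first exact: sqrtr_ge0.
  have -> : re (Num.sqrt t) - re (Num.sqrt t) * (1 - y) =
    re (Num.sqrt t) * y by ring.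
  by rewrite nrm_reM ger0_norm ?sqrtr_ge0 // ler_piMr ?sqrtr_ge0.
have -> : re (Num.sqrt t) * (1 - y) * (re (Num.sqrt t) * (1 - y)) =
   re (Num.sqrt t * Num.sqrt t) * ((1 - y) * (1 - y)) by ring.
rewrite -expr2 sqr_sqrtr ?ltW // yE.
have -> : re t * (1 - re t^-1 * (re t - a)) =
  a + (1 - re t * re t^-1) * (re t - a) by ring.
by rewrite reV // subrr mul0r addr0.
Qed.

Lemma pos_nrmB h : adj h = h -> pos (re (nrm h) - h).
Proof.
move=> sh; split; first by rewrite adjD adjN adj_re sh.
by exists (nrm h); rewrite ?nrm_ge0 // subKr.
Qed.

(* For [nrm h <= 1] the element [h + i sqrt (1 - h^2)] is unitary, so its
   imaginary part has norm at most [1]. *)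
Lemma pos_sqr h : adj h = h -> pos (h * h).
Proof.
move=> sh; pose r := nrm h + 1.
have r0 : 0 < r by rewrite ltr_wpDl ?nrm_ge0.
pose g := re r^-1 * h.
have sg : adj g = g by rewrite adjM adj_re sh mulrC.
have g1 : nrm (g * g) <= 1.
  apply: (le_trans (nrmM _ _)); apply: mulr_ile1; rewrite ?nrm_ge0 //;
  by rewrite nrm_reM gtr0_norm ?invr_gt0 // ler_pdivrMl // mulr1 lerDl.
have [y [y1 yE ys]] := sqrt_near1 g1.
have {}ys : adj y = y by apply: ys; rewrite adjM sg.
pose s := 1 - y; have ss : adj s = s by rewrite adjD adjN adj1 ys.
pose z := g + im * s.
have sz : adj z = g - im * s by rewrite adjD sg adjM ss adj_im; ring.
have z1 : nrm z <= 1.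
  have := nrm_adjM z; have := nrm_ge0 z.
  have -> : adj z * z = 1.
    rewrite sz; have -> : (g - im * s) * z = g * g - im * im * (s * s).
      by rewrite /z; ring.
    by rewrite imE yE; ring.
  have := @nrm1_le1 R A; nra.
have s1 : nrm s <= 1.
  (* This is [s = im (adj z - z) / 2] plus a term that vanishes by [imE] and [re_half]. Several
     later identities carry similar vanishing corrections. *)
  have -> : s = re 2^-1 * (im * (adj z - z)) +
     (1 + re 2^-1 * 2 * (im * im)) * s.
    by rewrite sz /z; ring.
  rewrite imE re_half mul1r subrr mul0r addr0.
  rewrite nrm_reM nrm_imM gtr0_norm ?invr_gt0 // ler_pdivrMl ?mulr1 //.
  by apply: (le_trans (nrmD _ _)); rewrite nrmN nrm_adj; lra.
have -> : h * h = re (r * r) * (g * g).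
  have -> : re (r * r) * (g * g) = (re r * re r^-1) ^+ 2 * (h * h).
    by rewrite /g; ring.
  by rewrite reV ?gt_eqF // expr1n mul1r.
apply: posZ; first by apply: mulr_ge0; apply: ltW.
split; first by rewrite adjM sg.
exists 1; rewrite ?ler01 // rmorph1 -yE -/s.
by apply: (le_trans (nrmM _ _)); apply: mulr_ile1; rewrite ?nrm_ge0.
Qed.

(** By commutativity [a b] is the square of the product of self-adjoint roots. *)
Lemma posM a b : pos a -> pos b -> pos (a * b).
Proof.
move=> /pos_sqrt[x [sx _] <-] /pos_sqrt[y [sy _] <-].
have -> : x * x * (y * y) = x * y * (x * y) by ring.
by apply: pos_sqr; rewrite adjM sx sy mulrC.
Qed.

Lemma cartesian z : exists h k,
  [/\ adj h = h, adj k = k & z = h + im * k].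
Proof.
exists (re 2^-1 * (z + adj z)), (re 2^-1 * (im * (adj z - z))).
split.
- by rewrite adjM adj_re adjD adjK; ring.
- by rewrite adjM adj_re adjM adj_im adjD adjN adjK; ring.
rewrite [RHS](_ : _ = re 2^-1 * 2 * z +
   re 2^-1 * (1 + im * im) * (adj z - z)); last by ring.
by rewrite imE re_half subrr; ring.
Qed.

Lemma pos_adjM z : pos (adj z * z).
Proof.
have [h [k [sh sk ->]]] := cartesian z.
have -> : adj (h + im * k) * (h + im * k) = h * h + k * k.
  rewrite adjD adjM sh sk adj_im.
  rewrite [LHS](_ : _ = h * h - (im * im) * (k * k)); last by ring.
  by rewrite imE; ring.
by apply: posD; apply: pos_sqr.
Qed.

(** If [a = x^2] and [r - a = y^2], then [z = x + im y] satisfies [adj z * z = r], so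
    [(nrm z)^2 <= r], and [x] is the real part of [z]. *)
Lemma pos_le_nrm a (r : R) : 0 <= r -> pos a -> pos (re r - a) ->
  nrm a <= r.
Proof.
move=> r0 /pos_sqrt[x [sx _] <-] /pos_sqrt[y [sy _] yE].
pose z := x + im * y.
have sz : adj z = x - im * y by rewrite adjD adjM sx sy adj_im; ring.
have nz : nrm z ^+ 2 <= r.
  rewrite -nrm_adjM.
  have -> : adj z * z = re r.
    rewrite sz [LHS](_ : _ = x * x - (im * im) * (y * y)).
      by rewrite imE yE; ring.
    by rewrite /z; ring.
  by apply: (le_trans (nrm_re _)); rewrite ger0_norm.
have -> : x * x = re 2^-1 * (z + adj z) * (re 2^-1 * (z + adj z)) +
   (1 - (re 2^-1 * 2) ^+ 2) * (x * x).
  by rewrite sz /z; ring.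
rewrite re_half expr1n subrr mul0r addr0.
have : nrm (re 2^-1 * (z + adj z)) <= nrm z.
  rewrite nrm_reM gtr0_norm ?invr_gt0 // ler_pdivrMl //.
  by apply: (le_trans (nrmD _ _)); rewrite nrm_adj; lra.
set p := re _ * _ => pz; apply: (le_trans (nrmM _ _)).
by apply: le_trans nz; rewrite expr2; apply: ler_pM; rewrite ?nrm_ge0.
Qed.

(** Factor [e + a = (e + t) (1 - q)]; here [nrm q <= t / (e + t) < 1], so the Neumann series
    applies. *)
Lemma pos_inv (e : R) a : 0 < e -> pos a -> exists v, (re e + a) * v = 1.
Proof.
move=> e0 [sa [t t0 ta]]; have et : 0 < e + t by rewrite ltr_wpDr.
pose q := re (e + t)^-1 * (re t - a).
have [|v vE] := @neumann _ _ q.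
  rewrite nrm_reM gtr0_norm ?invr_gt0 // ltr_pdivrMl // mulr1.
  by apply: (le_lt_trans ta); rewrite ltrDr.
exists (re (e + t)^-1 * v).
rewrite -{}vE /q.
have -> : (re e + a) * (re (e + t)^-1 * v) =
   re (e + t) * re (e + t)^-1 * v - re (e + t)^-1 * (re t - a) * v.
  by ring.
by rewrite reV ?gt_eqF //; ring.
Qed.

End Positivity.

(** * Maximal ideals and derivations *)

Section MaximalIdeals.
Context {R : realType} {A : comCStarType R}.
Implicit Types a b c h q u v w x y z : A.
Local Notation re := (@re R A).
Local Notation im := (@im R A).

Definition maximal_ideal (m : set A) :=
  [/\ forall a b, m a -> m b -> m (a + b),
      forall a b, m b -> m (a * b),
      ~ m 1 &
      forall a, ~ m a -> exists z, m (1 - a * z)].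

Lemma ex_maximal_ideal a : (forall v, a * v <> 1) ->
  exists2 m, maximal_ideal m & m a.
Proof.
move=> aV.
(* The last clause means empty or containing [a]: the empty set has to be in [P], being the union of
   the empty chain. *)
pose P := [set I : set A | [/\ forall x y, I x -> I y -> I (x + y),
  forall x y, I y -> I (x * y), ~ I 1 & forall x, I x -> I a]].
have [|m [[mD mM m1 ma] mmax]] := @Zorn_bigcup A P.
  move=> F FP Ftot; split.
  - move=> x y [X FX Xx] [Y FY Yy].
    have [XY|YX] := Ftot _ _ FX FY.
      by exists Y => //; have [YD _ _ _] := FP _ FY; apply: YD => //; apply: XY.
    by exists X => //; have [XD _ _ _] := FP _ FX; apply: XD => //; apply: YX.
  - move=> x y [Y FY Yy]; exists Y => //.
    by have [_ YM _ _] := FP _ FY; apply: YM.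
  - by move=> [X FX X1]; have [_ _ /(_ X1)] := FP _ FX.
  - by move=> x [X FX Xx]; exists X => //; have [_ _ _ /(_ _ Xx)] := FP _ FX.
have {}ma : m a.
  apply: contrapT => ma'; have m0 x : ~ m x by move/ma.
  (* An empty [m] would be strictly contained in the principal ideal of [a]. *)
  apply: (mmax [set x | exists v, x = a * v]).
    split; first by move=> x /m0.
    by move=> /(_ a) am; apply/ma'/am; exists 1; rewrite mulr1.
  split.
  - by move=> _ _ [v ->] [w ->]; exists (v + w); ring.
  - by move=> x _ [v ->]; exists (x * v); ring.
  - by move=> [v /esym/aV].
  - by move=> _ _; exists 1; rewrite mulr1.
exists m => //; split=> // b mb; apply: contrapT => bz.
(* If [b] had no inverse modulo [m], the ideal [m + b A] would be proper and strictly larger. *)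
apply: (mmax [set x | exists i v, m i /\ x = i + b * v]).
  split; first by move=> x mx; exists x, 0; split=> //; ring.
  move=> /(_ b) am; apply/mb/am; exists (0 * a), 1; split; first exact: mM.
  by ring.
split.
- move=> _ _ [i [v [mi ->]]] [j [w [mj ->]]]; exists (i + j), (v + w).
  by split; [exact: mD|ring].
- move=> x _ [i [v [mi ->]]]; exists (x * i), (x * v).
  by split; [exact: mM|ring].
- by move=> [i [v [mi iv]]]; apply: bz; exists v; rewrite iv addrK.
- by move=> _ _; exists a, 0; split=> //; ring.
Qed.

Section MaximalIdeal.
Context {m : set A} (mP : maximal_ideal m).

Let mD a b : m a -> m b -> m (a + b).
Proof. by case: mP => + _ _ _; exact. Qed.

Let mM a b : m b -> m (a * b).
Proof. by case: mP => _ + _ _; exact. Qed.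

Let mB a b : m a -> m b -> m (a - b).
Proof. by move=> ma mb; rewrite -[b]mul1r -mulNr; apply/mD/mM. Qed.

Let m0 : m 0.
Proof.
apply: contrapT => m0'; case: mP => _ _ _ /(_ _ m0')[z]; rewrite mul0r subr0.
by case: mP.
Qed.

Lemma maximal_ideal_prime a b : m (a * b) -> m a \/ m b.
Proof.
move=> mab; have [ma|ma] := pselect (m a); [by left|right].
case: mP => _ _ _ /(_ _ ma)[z mz].
have -> : b = b * (1 - a * z) + z * (a * b) by ring.
by apply: mD; apply: mM.
Qed.

Lemma maximal_idealN_pos (e : R) a : 0 < e -> pos a -> ~ m (re e + a).
Proof.
move=> e0 /(pos_inv e0)[v vE] mea; case: mP => _ _ + _; apply.
by rewrite -vE mulrC; apply: mM.
Qed.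

(** With [g] the positive root of [h^2], the product [(h - g) (h + g)] is zero and [m] is prime. *)
Lemma pos_mod_total h : adj h = h ->
  exists2 a, pos a & m (h - a) \/ m (- h - a).
Proof.
move=> sh; have [g pg gE] := pos_sqrt (pos_sqr sh).
exists g => //.
have : m ((h - g) * (h + g)).
  by rewrite [X in m X](_ : _ = h * h - g * g); [rewrite gE subrr|ring].
move=> /maximal_ideal_prime[]; [by left|right].
by rewrite -opprD -mulN1r; apply: mM.
Qed.

(* The supremum [l] of the reals [r] such that [h - r] is positive modulo [m].
   If [j = h - l] had an inverse [z] modulo [m], then
   [|1 - j z|^2 + |j z|^2 >= 1/2], whereas modulo [m] the first term vanishes
   and [j^2] is bounded by arbitrarily small scalars, because
   [(j + e1) (e2 - j)] is positive modulo [m] for small [e1] and [e2]. *)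
Lemma real_mod_maximal h : adj h = h -> exists l : R, m (h - re l).
Proof.
move=> sh.
pose T := [set r : R | exists2 a, pos a & m (h - re r - a)].
have Tn : T (- nrm h).
  exists (re (nrm h) + h).
    by have := @pos_nrmB _ _ (- h); rewrite adjN sh nrmN opprK; apply.
  by rewrite [X in m X](_ : _ = 0) //; ring.
have Tub r : T r -> r <= nrm h.
  move=> [a pa ma]; rewrite leNgt; apply/negP => hr.
  have r0 : 0 < r - nrm h by rewrite subr_gt0.
  apply: (@maximal_idealN_pos (r - nrm h) (a + (re (nrm h) - h))) => //.
    by apply: posD => //; apply: pos_nrmB.
  rewrite [X in m X](_ : _ = 0 - (h - re r - a)); first exact: mB.
  by ring.
have Tsup : has_sup T by split; [exists (- nrm h)|exists (nrm h)].
pose l := sup T; exists l.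
pose j := h - re l; have sj : adj j = j by rewrite adjD adjN adj_re sh.
apply: contrapT => mj; case: mP => _ _ _ /(_ _ mj)[z mz].
pose N := nrm (adj z * z) + 1.
have N0 : 0 < N by rewrite ltr_wpDl ?nrm_ge0.
have nj0 : 0 < nrm j + 1 by rewrite ltr_wpDl ?nrm_ge0.
(* As [0 <= d < e <= 1] below, this choice makes [k >= 1/4]. *)
pose e := (4 * (N * (nrm j + 1)))^-1.
have eE : N * (nrm j + 1) * e = 4^-1.
  by rewrite /e invfM mulrCA mulfV ?mulr1 // gt_eqF ?mulr_gt0.
have e0 : 0 < e by rewrite invr_gt0 !mulr_gt0.
have e1 : e <= 1.
  have X1 : 1 <= N * (nrm j + 1) by apply: mulr_ege1; rewrite lerDr nrm_ge0.
  by move: X1 eE e0; move: (N * _) (e) => X e'; nra.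
have [r [a pa ma] lr] := sup_adherent e0 Tsup.
have rl : r <= l by apply: sup_upper_bound => //; exists a.
have sh2 : adj (h - re (l + e)) = h - re (l + e) by rewrite adjD adjN adj_re sh.
(* Since [l] is the supremum, [h - (l + e)] is not positive modulo [m], so its opposite is. *)
have [b pb mb] : exists2 b, pos b & m (re (l + e) - h - b).
  have [b pb [mb|mb]] := pos_mod_total sh2; exists b => //; last first.
    by rewrite opprB in mb.
  have : l + e <= l by apply: sup_upper_bound => //; exists b.
  lra.
pose d := l - r; have d0 : 0 <= d by rewrite subr_ge0.
have de : d < e by rewrite /d -/l in lr *; lra.
(* [S] enters through [|1 - j z|^2 + |j z|^2 = (1 + S) / 2]. *)
pose S := adj (1 - 2 * j * z) * (1 - 2 * j * z).
have pS : pos S by exact: pos_adjM.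
have pz : pos (re N - adj z * z).
  rewrite rmorphD rmorph1 addrAC; apply: posD.
    by apply: pos_nrmB; rewrite adjM adjK mulrC.
  by rewrite -(rmorph1 re); apply: pos_re.
have pj : pos (re (nrm j) - j) by exact: pos_nrmB.
pose k := 2^-1 - N * d * e - N * (e - d) * nrm j.
have k0 : 0 < k.
  have := nrm_ge0 j; rewrite /k.
  have : 0 <= N * e * (1 - d).
    by apply: mulr_ge0; [apply: mulr_ge0; exact: ltW|lra].
  have : 0 <= N * d * nrm j by rewrite !mulr_ge0 ?nrm_ge0 // ltW.
  by rewrite mulrDr mulrDl in eE; lra.
apply: (@maximal_idealN_pos k (re 2^-1 * S + j * j * (re N - adj z * z) +
   re N * (a * b) + re (N * (e - d)) * (re (nrm j) - j))) => //.
  apply: posD; last by apply: posZ => //; rewrite mulr_ge0 ?subr_ge0 // ltW.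
  apply: posD; last first.
    by apply: posZ; [rewrite ltW|exact: posM].
  by apply: posD; [apply: posZ|apply: posM => //; exact: pos_sqr].
have sD : adj (1 - 2 * j * z) = 1 - 2 * j * adj z.
  have -> : 1 - 2 * j * z = 1 - (j + j) * z by ring.
  by rewrite adjD adj1 adjN adjM adjD sj; ring.
(* The right side lies in [m]: modulo [m], [j z] is [1], [j + d] is [a] and [e - j] is [b]. *)
have lhs : re k + (re 2^-1 * S + j * j * (re N - adj z * z) +
   re N * (a * b) + re (N * (e - d)) * (re (nrm j) - j)) =
   (1 - j * adj z) * (1 - j * z) - re N * ((j + re d) * (re e - j) - a * b) +
   (re 2^-1 * 2 - 1) * (1 - j * (z + adj z) + 2 * j * j * (z * adj z)).
  by rewrite /S sD /k; ring.
rewrite lhs re_half subrr mul0r addr0; apply: mB; first exact: mM.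
apply: (mM); have -> : (j + re d) * (re e - j) - a * b =
    (re e - j) * (h - re r - a) + a * (re (l + e) - h - b).
  by rewrite /j /d; ring.
by apply: mD; apply: mM.
Qed.

End MaximalIdeal.

End MaximalIdeals.

(** * Vanishing of derivations of a commutative C*-algebra *)

Section CommutativeDerivation.
Context {R : realType} {A : comCStarType R}.
Implicit Types a b c h q u v w x y z : A.
Local Notation re := (@re R A).
Local Notation im := (@im R A).

Section DerivationZero.
Context (D : A -> A).
Hypothesis DD : forall a b, D (a + b) = D a + D b.
Hypothesis Dre : forall r a, D (re r * a) = re r * D a.
Hypothesis Dim : forall a, D (im * a) = im * D a.
Hypothesis DM : forall a b, D (a * b) = D a * b + a * D b.

Lemma derivation_re r : D (re r) = 0.
Proof.
have D1 : D 1 = 0.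
  by have := DM 1 1; rewrite !mulr1 mul1r -[LHS]addr0 => /addrI/esym.
by rewrite -[re r]mulr1 Dre D1 mulr0.
Qed.

(* If [k] is self-adjoint of norm at most [1], then [k^2 + i k] lies in the unit
   disc around [1] and so has a square root [z].  When [k] is in the prime ideal
   [m] so is [z], and [(2 k + i) D k = 2 z D z]. *)
Lemma derivation_maximal_ideal m j : maximal_ideal m -> adj j = j -> m j ->
  m (D j).
Proof.
move=> mP sj mj; have [mD mM _ _] := mP.
pose r := nrm j + 1; have r0 : 0 < r by rewrite ltr_wpDl ?nrm_ge0.
pose k := re r^-1 * j.
have sk : adj k = k by rewrite adjM adj_re sj mulrC.
have nk : nrm k <= 1.
  by rewrite nrm_reM gtr0_norm ?invr_gt0 // ler_pdivrMl // mulr1 lerDl.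
have pk2 : pos (1 - k * k).
  rewrite -(rmorph1 re); split; first by rewrite adjD adjN adj_re adjM sk.
  exists 1; rewrite ?ler01 // subKr; apply: (le_trans (nrmM _ _)).
  by apply: mulr_ile1; rewrite ?nrm_ge0.
pose w := k * k + im * k.
have nw : nrm (1 - w) <= 1.
  suff : nrm (adj (1 - w) * (1 - w)) <= 1.
    by rewrite nrm_adjM; have := nrm_ge0 (1 - w); nra.
  (* Here [|1 - w|^2 = 1 - k^2 (1 - k^2)], and the subtracted product is positive. *)
  have -> : adj (1 - w) * (1 - w) = (1 - k * k) + k * k * (k * k).
    rewrite /w adjD adj1 adjN adjD adjM [adj (im * k)]adjM sk adj_im.
    rewrite [LHS](_ : _ = (1 - k * k) * (1 - k * k) - im * im * (k * k)).
      by rewrite imE; ring.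
    by ring.
  apply: pos_le_nrm => //.
    by apply: posD => //; apply: pos_sqr; rewrite adjM sk.
  rewrite rmorph1 [X in pos X](_ : _ = k * k * (1 - k * k)); last by ring.
  by apply: posM => //; exact: pos_sqr.
have [y [_ zE _]] := sqrt_near1 nw; rewrite subKr in zE.
set z := 1 - y in zE.
have mk : m k by exact: mM.
have mz : m z.
  have : m (z * z).
    by rewrite zE (_ : w = (k + im) * k); [exact: mM|rewrite /w; ring].
  by case/(maximal_ideal_prime mP).
have -> : D j = re r * D k.
  by rewrite -Dre /k mulrA reV ?gt_eqF // mul1r.
apply: (mM).
have Dw : D z * z + z * D z = D k * k + k * D k + im * D k.
  by rewrite -DM zE DD Dim DM.
have -> : D k = - (2 * im * D z) * z + (2 * im * D k) * k.
  rewrite [RHS](_ : _ = - im * (D z * z + z * D z) +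
     im * (D k * k + k * D k)); last by ring.
  rewrite Dw [RHS](_ : _ = - (im * im) * D k); last by ring.
  by rewrite imE opprK mul1r.
by apply: mD; exact: mM.
Qed.

(** Since [D] kills real scalars, [k = D h] lies in every maximal ideal. If [k] is nonzero,
    [c = |k|^2 / (nrm k)^2] has norm [1]. No maximal ideal contains [1 - c], so it has an inverse
    [v], which is positive and bounded by some [N]. Then [1 - c >= 1/N], which contradicts
    [nrm c = 1]. *)
Lemma derivation_self_adjoint h : adj h = h -> D h = 0.
Proof.
move=> sh; set k := D h.
have mk m : maximal_ideal m -> m k.
  move=> mP; have [l ml] := real_mod_maximal mP sh.
  have -> : k = D (h - re l).
    by rewrite DD -mulN1r -(rmorphN1 re) Dre derivation_re mulr0 addr0.
  by apply: derivation_maximal_ideal => //; rewrite adjD adjN adj_re sh.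
apply: nrm0_eq0; apply: contrapT => nk0.
have nk : 0 < nrm k by rewrite lt_neqAle nrm_ge0 andbT eq_sym; apply/eqP.
pose c := re (nrm k ^+ 2)^-1 * (adj k * k).
have k2 : 0 <= (nrm k ^+ 2)^-1 by rewrite invr_ge0 exprn_ge0 ?nrm_ge0.
have pc : pos c by apply: posZ => //; exact: pos_adjM.
have nc : nrm c = 1.
  by rewrite nrm_reM nrm_adjM ger0_norm // mulVf // expf_neq0 ?gt_eqF.
have pd : pos (1 - c).
  by have := pos_nrmB (proj1 pc); rewrite nc rmorph1.
have [[v vE]|nv] := pselect (exists v, (1 - c) * v = 1); last first.
  have /ex_maximal_ideal[m mP mc] : forall v, (1 - c) * v <> 1.
    by move=> v cv; apply: nv; exists v.
  have [mD mM m1 _] := mP; apply: m1.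
  have -> : 1 = (1 - c) + re (nrm k ^+ 2)^-1 * adj k * k by rewrite /c; ring.
  by apply: mD => //; apply: mM; apply: mk.
have sd : adj (1 - c) = 1 - c by case: pd.
have vs : (1 - c) * adj v = 1.
  by have := congr1 adj vE; rewrite adjM sd adj1 mulrC.
have sv : adj v = v.
  have -> : adj v = (1 - c) * adj v * v - adj v * ((1 - c) * v - 1) by ring.
  by rewrite vs vE; ring.
pose N := nrm v + 1; have N1 : 1 <= N by rewrite lerDr nrm_ge0.
have pv : pos v.
  have -> : v = v * v * (1 - c) - v * ((1 - c) * v - 1) by ring.
  by rewrite vE subrr mulr0 subr0; apply: posM => //; exact: pos_sqr.
have pN : pos (re N - v).
  rewrite rmorphD addrAC; apply: posD; first exact: pos_nrmB.
  by apply: pos_re; exact: ler01.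
have : pos (re N^-1 * ((1 - c) * (re N - v))).
  by apply: posZ; [rewrite invr_ge0 (le_trans ler01)|exact: posM].
have -> : re N^-1 * ((1 - c) * (re N - v)) =
    re (1 - N^-1) - c + (re N * re N^-1 - 1) * (1 - c) -
    re N^-1 * ((1 - c) * v - 1).
  by ring.
have N0 : 0 < N by exact: lt_le_trans ltr01 N1.
rewrite reV ?gt_eqF // vE !subrr mul0r mulr0 addr0 subr0 => pcN.
have : nrm c <= 1 - N^-1.
  by apply: pos_le_nrm => //; rewrite subr_ge0 invf_le1.
have : 0 < N^-1 by rewrite invr_gt0.
by rewrite nc; lra.
Qed.

Lemma derivation_eq0 a : D a = 0.
Proof.
have [h [k [sh sk ->]]] := cartesian a.
by rewrite DD Dim !derivation_self_adjoint // mulr0 addr0.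
Qed.

End DerivationZero.

End CommutativeDerivation.

(** * Consequences of having no nilpotents *)

Section Reduced.
Context {R : realType} {A : comCStarType R}.
Implicit Types a b c h q u v w x y z : A.
Local Notation re := (@re R A).
Local Notation im := (@im R A).

(** By the C*-identity, [adj b * b = 0] forces [b = 0]; this is used for [b = adj a * a] and then
    for [b = a]. *)
Lemma sqr_eq0 a : a * a = 0 -> a = 0.
Proof.
have adj_eq0 b : adj b * b = 0 -> b = 0.
  move=> b0; apply/nrm0_eq0/eqP; rewrite -sqrf_eq0 -nrm_adjM b0.
  by rewrite nrm0.
move=> a0; apply/adj_eq0/adj_eq0.
rewrite adjM adjK [LHS](_ : _ = adj a * adj a * (a * a)); last by ring.
by rewrite a0 mulr0.
Qed.

Lemma double_eq0 a : a + a = 0 -> a = 0.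
Proof.
move=> a0; have -> : a = re 2^-1 * (a + a) - (re 2^-1 * 2 - 1) * a by ring.
by rewrite a0 re_half subrr; ring.
Qed.

(** The diagonal case gives [c x * u x = 0]; by the hypothesis, the square of [c z * u x] is then a
    multiple of that product. *)
Lemma cross_eq0 (X : Type) (c u : X -> A) :
  (forall x z : X, c z * u x + u z * c x = 0) ->
  forall x z : X, c z * u x = 0.
Proof.
move=> cu x z; have cxu t : c t * u t = 0.
  by apply: double_eq0; rewrite -[RHS](cu t t); ring.
apply: sqr_eq0; have -> : c z * u x * (c z * u x) =
   (c z * u x + u z * c x) * (c z * u x) - u z * c z * (c x * u x) by ring.
by rewrite cu cxu; ring.
Qed.

Lemma cross_eq0r a b c d : a * d + c * b = 0 -> a * b = 0 -> a * d = 0.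
Proof.
move=> adcb ab; apply: sqr_eq0.
have -> : a * d * (a * d) = (a * d + c * b) * (a * d) - c * d * (a * b) by ring.
by rewrite adcb ab; ring.
Qed.

End Reduced.

(** * Jordan derivations *)

Lemma cstar_derivation_eq0 {R : realType} {A : cstarAlgType R}
    (hA : commutative (@GRing.mul A)) (D : A -> A) :
  linear D -> (forall a b, D (a * b) = D a * b + a * D b) -> forall a, D a = 0.
Proof.
move=> Dl DM; have D0 : D 0 = 0.
  by have := Dl (-1) 0 0; rewrite scaler0 addr0 scaleN1r addNr.
have DZ k a : D (scal k * a) = scal k * D a.
  by rewrite -!scalE; have := Dl k a 0; rewrite D0 !addr0.
apply: (@derivation_eq0 R (comm_alg hA)) => // [a b|r a|a].
- by have := Dl 1 a b; rewrite !scale1r.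
- exact: DZ.
- exact: DZ.
Qed.

(** * Normalization of identities in noncommutative rings *)

Section NoncommutativeRing.
Context {B : pzRingType}.

#[global] Instance nc_ops :
  @Ncring.Ring_ops B 0 1 +%R *%R (fun x y => x - y) -%R eq := {}.

#[global] Instance nc_ring :
  @Ncring.Ring B 0 1 +%R *%R (fun x y => x - y) -%R eq nc_ops.
Proof.
split; first [by move=> x y -> u v -> | by move=> x y ->
  | exact (@add0r B) | exact (@addrC B) | exact (@addrA B) | exact (@mul1r B)
  | exact (@mulr1 B) | exact (@mulrA B) | exact (@mulrDl B)
  | exact (fun x y z => @mulrDr B z x y) | exact (@subrr B) | by []
  | exact _].
Qed.

End NoncommutativeRing.

Ltac nc_ring := Ncring_tac.non_commutative_ring.

Section JordanDerivation.
Context {B : pzRingType}.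

Context (J : B -> B).
Hypothesis torsion2 : forall x : B, x + x = 0 -> x = 0.
Hypothesis JD : forall x y, J (x + y) = J x + J y.
Hypothesis JS : forall x, J (x * x) = J x * x + x * J x.
Implicit Types a b r x y z : B.

Let JN x : J (- x) = - J x.
Proof.
have J0 : J 0 = 0 by apply: (addrI (J 0)); rewrite -JD !addr0.
by apply/eqP; rewrite -subr_eq0 opprK -JD addNr J0.
Qed.

Lemma jordan_sym x y :
  J (x * y + y * x) = J x * y + x * J y + J y * x + y * J x.
Proof.
have -> : x * y + y * x = (x + y) * (x + y) + - (x * x) + - (y * y) by nc_ring.
by rewrite !JD !JN !JS JD; nc_ring.
Qed.

(** With [x o y = x y + y x], one has [2 x r x = x o (x o r) - x^2 o r], to which [jordan_sym]
    applies. *)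
Lemma jordan_triple x r :
  J (x * r * x) = J x * r * x + x * J r * x + x * r * J x.
Proof.
apply/subr0_eq/torsion2.
set E := J x * r * x + x * J r * x + x * r * J x.
have -> : J (x * r * x) - E + (J (x * r * x) - E) =
    J (x * r * x) + J (x * r * x) - (E + E) by nc_ring.
rewrite -JD.
have -> : x * r * x + x * r * x = x * (x * r + r * x) + (x * r + r * x) * x +
   - (x * x * r + r * (x * x)) by nc_ring.
by rewrite JD JN !jordan_sym JS /E; nc_ring.
Qed.

Lemma jordan_triple_sym x r z : J (x * r * z + z * r * x) =
  J x * r * z + x * J r * z + x * r * J z +
  J z * r * x + z * J r * x + z * r * J x.
Proof.
have -> : x * r * z + z * r * x =
  (x + z) * r * (x + z) + - (x * r * x) + - (z * r * z) by nc_ring.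
by rewrite !JD !JN !jordan_triple JD; nc_ring.
Qed.

Definition jordan_defect a b := J (a * b) - J a * b - a * J b.

(* Herstein: evaluate [J] on [a b r b a + b a r a b] in two ways. *)
Lemma jordan_defect_cross a b r :
  jordan_defect a b * r * (a * b - b * a) +
  (a * b - b * a) * r * jordan_defect a b = 0.
Proof.
(* Eliminating [J (b a)] makes the defect of [(b, a)] the opposite of that of [(a, b)]. *)
have Jba : J (b * a) =
    J a * b + a * J b + J b * a + b * J a - J (a * b).
  by rewrite -jordan_sym JD; nc_ring.
have := jordan_triple_sym (a * b) r (b * a).
have -> : a * b * r * (b * a) + b * a * r * (a * b) =
  a * (b * r * b) * a + b * (a * r * a) * b by nc_ring.
rewrite JD !jordan_triple Jba /jordan_defect => E.
set L := (X in X = _) in E; set Q := (X in _ = X) in E.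
have <- : L - Q = 0 by rewrite E subrr.
by rewrite /L /Q; nc_ring.
Qed.

(** Both sides of the second hypothesis add up to [J (a b + b a) = 2 J (a b)]. *)
Lemma jordan_defect_comm a b : a * b = b * a ->
  J a * b + a * J b = J b * a + b * J a -> jordan_defect a b = 0.
Proof.
move=> ab Jab; apply: torsion2; have E := jordan_sym a b.
rewrite -ab JD in E; rewrite /jordan_defect.
have -> : J (a * b) - J a * b - a * J b + (J (a * b) - J a * b - a * J b) =
  J (a * b) + J (a * b) - (J a * b + a * J b) - (J a * b + a * J b) by nc_ring.
by rewrite E {2}Jab; nc_ring.
Qed.

End JordanDerivation.

(** * Hilbert modules *)

Section HilbertModuleFacts.
Context {R : realType} {A : cstarAlgType R} {M : hilbertModType A}.
Hypothesis hA : commutative (@GRing.mul A).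
Implicit Types (a b : A) (x y z w : M) (T Z : endA M).

Lemma innerDl x y z : inner (x + y) z = inner x z + inner y z :> A.
Proof. by have := inner_linl 1 x y z; rewrite !scale1r. Qed.

Lemma inner0l z : inner (0 : M) z = 0 :> A.
Proof. by apply: (addrI (inner (0 : M) z)); rewrite -innerDl !addr0. Qed.

Lemma innerZl k x z : inner (k *: x) z = k *: inner x z :> A.
Proof. by have := inner_linl k x 0 z; rewrite inner0l !addr0. Qed.

Lemma innerNl x z : inner (- x) z = - inner x z :> A.
Proof. by rewrite -scaleN1r innerZl scaleN1r. Qed.

Lemma innerDr x y z : inner x (y + z) = inner x y + inner x z :> A.
Proof. by rewrite inner_star innerDl starD -!inner_star. Qed.

Lemma innerZr k x z : inner x (k *: z) = (k^* *: inner x z : A).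
Proof. by rewrite inner_star innerZl starZ -inner_star. Qed.

Lemma innerNr x z : inner x (- z) = - inner x z :> A.
Proof. by rewrite inner_star innerNl starN -inner_star. Qed.

Lemma inner_actr a x y : inner x (act a y) = inner x y * star a.
Proof. by rewrite inner_star inner_actl star_mul -inner_star. Qed.

Lemma rnorm_inner x : rnorm (inner x x : A) = rnorm x ^+ 2.
Proof.
by apply: complexI; rewrite rmorphXn /= -!rnormE (hilb_normE x) sqrtCK.
Qed.

Lemma endAD T x y : T (x + y) = T x + T y.
Proof. by have [Tl _ _] := endAP T; have := Tl 1 x y; rewrite !scale1r. Qed.

Lemma endA0 T : T 0 = 0.
Proof. by apply: (addrI (T 0)); rewrite -endAD !addr0. Qed.

Lemma endAZ T (k : R[i]) x : T (k *: x) = k *: T x.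
Proof.
by have [Tl _ _] := endAP T; have := Tl k x 0; rewrite endA0 !addr0.
Qed.

Lemma endA_act T a x : T (act a x) = act a (T x).
Proof. by have [_ Ta _] := endAP T. Qed.

Lemma act0l x : act (0 : A) x = 0.
Proof. by apply: (addrI (act 0 x)); rewrite -actDl !addr0. Qed.

Lemma endA_bound (T : M -> M) (C : R) :
  (forall x, rnorm (T x) <= C * rnorm x) ->
  exists C : R[i], forall x : M, `|T x| <= C * `|x|.
Proof.
by move=> TC; exists C%:C%C => x; rewrite !rnormE -rmorphM lecR.
Qed.

Lemma polarization x y : rscal 4 * inner x y =
  inner (x + y) (x + y) - inner (x - y) (x - y) +
  ii * (inner (x + 'i%C *: y) (x + 'i%C *: y) -
        inner (x - 'i%C *: y) (x - 'i%C *: y)) :> A.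
Proof.
have ciE : ('i%C : R[i])^* = - 'i%C.
  by apply/eqP; rewrite eq_complex /= oppr0 !eqxx.
have subE z : inner (x + z) (x + z) - inner (x - z) (x - z) =
    inner x z + inner z x + (inner x z + inner z x) :> A.
  by rewrite !(innerDl, innerDr, innerNl, innerNr); nc_ring.
rewrite !subE innerZl innerZr ciE scaleNr !scalE -/ii.
rewrite [RHS](_ : _ = inner x y + inner y x + (inner x y + inner y x) -
   ii * ii * (inner x y + inner x y - (inner y x + inner y x))).
  rewrite iiE (_ : rscal 4 = 1 + 1 + 1 + 1); first by nc_ring.
  by rewrite (rmorph_nat (@rscal R A)) -[4%N]/(1 + 1 + 1 + 1)%N !natrD.
by nc_ring.
Qed.

(** Polarization gives a bound that replaces the Cauchy-Schwarz inequality; it is weaker, but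
    suffices for the boundedness of [theta]. *)
Lemma rnorm_inner_le2 x y : rnorm (inner x y : A) <= (rnorm x + rnorm y) ^+ 2.
Proof.
have sq z : rnorm z = rnorm y ->
    rnorm (inner (x + z) (x + z) : A) <= (rnorm x + rnorm y) ^+ 2.
  move=> <-; rewrite rnorm_inner ler_pXn2r ?nnegrE ?addr_ge0 ?rnorm_ge0 //.
  exact: rnormD.
have sqB z : rnorm z = rnorm y ->
    rnorm (inner (x + z) (x + z) - inner (x - z) (x - z) : A) <=
    (rnorm x + rnorm y) ^+ 2 *+ 2.
  move=> zy; apply: (le_trans (rnormD _ _)); rewrite rnormN mulr2n.
  by apply: lerD; apply: sq; rewrite ?rnormN.
rewrite -(@ler_pM2l _ 4) // -[4 in leLHS]ger0_norm // -rnorm_rscalM.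
rewrite polarization.
apply: (le_trans (rnormD _ _)); rewrite rnorm_iiM.
have -> : 4 * (rnorm x + rnorm y) ^+ 2 =
  (rnorm x + rnorm y) ^+ 2 *+ 2 + (rnorm x + rnorm y) ^+ 2 *+ 2 by ring.
by apply: lerD; apply: sqB; rewrite ?rnormZi.
Qed.

(** Normalizing [x] to norm [1] in the previous bound makes it linear in [rnorm x]. *)
Lemma rnorm_inner_le x y :
  rnorm (inner x y : A) <= (1 + rnorm y) ^+ 2 * rnorm x.
Proof.
have [x0|x0] := eqVneq (rnorm x) 0.
  by rewrite (rnorm0_eq0 x0) inner0l !rnorm0 mulr0.
have xgt0 : 0 < rnorm x by rewrite lt_neqAle eq_sym x0 rnorm_ge0.
pose u := (rnorm x)^-1%:C%C *: x.
have nu : rnorm u = 1 by rewrite rnormZ gtr0_norm ?invr_gt0 // mulVf.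
have xE : x = (rnorm x)%:C%C *: u.
  by rewrite scalerA -rmorphM mulfV // rmorph1 scale1r.
rewrite {1}xE innerZl rnormZ ger0_norm ?rnorm_ge0 // mulrC.
by apply: ler_wpM2r; rewrite ?rnorm_ge0 // -nu rnorm_inner_le2.
Qed.

Lemma rnorm_act_le a x : rnorm (act a x) <= rnorm a * rnorm x.
Proof.
rewrite -(@ler_pXn2r _ 2) ?nnegrE ?mulr_ge0 ?rnorm_ge0 // -rnorm_inner.
rewrite inner_actl inner_actr mulrA exprMn -rnorm_inner.
apply: (le_trans (rnormM _ _)); rewrite rnorm_star expr2 mulrAC.
by apply: ler_wpM2r; rewrite ?rnorm_ge0 ?rnormM.
Qed.

Lemma is_endA_act a : is_endA (act a : M -> M).
Proof.
split=> [k x y|b x|]; first by rewrite actDr actZr.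
  by rewrite -!actM hA.
by apply: (@endA_bound _ (rnorm a)) => x; exact: rnorm_act_le.
Qed.

Definition act_op a : endA M := EndA (asboolT (is_endA_act a)).

Lemma is_endA_theta x y : is_endA (fun z : M => act (inner z y : A) x).
Proof.
split=> [k z w|b z|]; first by rewrite innerDl innerZl actDl actZl.
  by rewrite inner_actl actM.
apply: (@endA_bound _ ((1 + rnorm y) ^+ 2 * rnorm x)) => z.
apply: (le_trans (rnorm_act_le _ _)); rewrite mulrAC.
by apply: ler_wpM2r; rewrite ?rnorm_ge0 ?rnorm_inner_le.
Qed.

Definition theta x y : endA M := EndA (asboolT (is_endA_theta x y)).

Lemma theta_sandwich x y T :
  theta x y * T * theta x y = act_op (inner (T x) y) * theta x y.
Proof.
apply: endA_inj => z /=; rewrite endA_act inner_actl.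
by rewrite -actM hA.
Qed.

Lemma act_op_central a T : act_op a * T = T * act_op a.
Proof. by apply: endA_inj => z /=; rewrite endA_act. Qed.

End HilbertModuleFacts.

(** * The center of the endomorphism algebra and 2-local derivations *)

Section TwoLocal.
Context {R : realType} {A : cstarAlgType R} {M : hilbertModType A}.
Hypothesis hA : commutative (@GRing.mul A).
Hypothesis hM : full M.
Implicit Types (a b : A) (x y z w : M) (S T Z : endA M).

Let Lop a : endA M := act_op hA a.

(** By fullness some finite sum is at distance less than [1] from [1], hence invertible. *)
Lemma full_unit : exists n (k : 'I_n -> R[i]) (x y : 'I_n -> M) (v : A),
  (\sum_(i < n) k i *: inner (x i) (y i)) * v = 1.
Proof.
have : closure (inner_span M) (1 : A) by rewrite hM.
move=> /(_ _ (nbhsx_ballx (1 : A) 1 ltr01)) [s [[n [k [x [y sE]]]]]].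
rewrite -ball_normE /ball_ /= rnormE -(rmorph1 (real_complex R)) ltcR => s1.
have [v vE] := @neumann R (comm_alg hA) (1 - s) s1.
by exists n, k, x, y, v; rewrite -sE -vE subKr.
Qed.

(** Commuting [Z] with [theta z y] and evaluating at [x] gives [<x, y> Z z = <Z x, y> z]; the sum of
    [full_unit] then isolates [Z z]. *)
Lemma center_endA Z : (forall T, Z * T = T * Z) -> exists a, Z = Lop a.
Proof.
move=> ZC; have [n [k [x [y [v vE]]]]] := full_unit.
exists (v * \sum_(i < n) k i *: inner (Z (x i)) (y i)).
apply: endA_inj => z /=.
have act_sum (f : 'I_n -> A) t :
    act (\sum_(i < n) f i) t = \sum_(i < n) act (f i) t.
  exact: (big_morph (fun a => act a t) (fun a b => actDl a b t) (act0l t)).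
have Z_sum (f : 'I_n -> M) : Z (\sum_(i < n) f i) = \sum_(i < n) Z (f i).
  exact: (big_morph Z (endAD Z) (endA0 Z)).
have zE : z = act v (\sum_(i < n) act (k i *: inner (x i) (y i)) z).
  by rewrite -act_sum -actM hA vE act1.
rewrite {1}zE endA_act Z_sum actM act_sum.
congr act; apply: eq_bigr => i _; rewrite !actZl endAZ; congr (_ *: _).
by have := congr1 (fun T : endA M => T (x i)) (ZC (theta z (y i))).
Qed.

Lemma act_op_inj a b : Lop a = Lop b -> a = b.
Proof.
move=> ab; have [n [k [x [y [v vE]]]]] := full_unit.
have E w z : a * inner w z = b * inner w z.
  rewrite -!inner_actl; congr inner.
  exact: (congr1 (fun T : endA M => T w) ab).
rewrite -[a]mulr1 -[b]mulr1 -vE !mulrA; congr (_ * v).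
by rewrite !mulr_sumr; apply: eq_bigr => i _; rewrite -!scale_mulAr E.
Qed.

Lemma act_opD a b : Lop (a + b) = Lop a + Lop b.
Proof. by apply: endA_inj => z /=; rewrite actDl. Qed.

Lemma act_opZ k a : Lop (k *: a) = k *: Lop a.
Proof. by apply: endA_inj => z /=; rewrite actZl. Qed.

Lemma act_opM a b : Lop (a * b) = Lop a * Lop b.
Proof. by apply: endA_inj => z /=; rewrite actM. Qed.

(** Differentiating [T b = b T] shows that [d] preserves the center, a copy of [A], on which it
    induces a derivation of [A]. *)
Lemma derivation_act_op d a :
  is_derivation (@GRing.mul (endA M)) d -> d (Lop a) = 0.
Proof.
move=> [dl dM].
have dcenter b : exists c, d (Lop b) = Lop c.
  apply: center_endA => T.
  have := dM T (Lop b); rewrite -(act_op_central hA) dM.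
  by rewrite (act_op_central hA b) [RHS]addrC => /addIr.
have [D DE] := choice dcenter.
rewrite DE (@cstar_derivation_eq0 _ _ hA D).
- by apply: endA_inj => z; rewrite /= act0l.
- move=> k b c; apply: act_op_inj.
  by rewrite act_opD act_opZ -!DE act_opD act_opZ dl.
- move=> b c; apply: act_op_inj.
  by rewrite act_opD !act_opM -!DE -dM -act_opM.
Qed.

Context (delta : endA M -> endA M).
Hypothesis hdelta : is_2local_derivation (@GRing.mul (endA M)) delta.

(** Here and in the next two lemmas, one derivation chosen for the two arguments computes both
    values. *)
Lemma delta_scale k T : delta (k *: T) = k *: delta T.
Proof.
have [d [[dl _] -> ->]] := hdelta (k *: T) T.
have d0 : d 0 = 0.
  by have := dl (-1) 0 0; rewrite scaler0 addr0 scaleN1r addNr.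
by have := dl k T 0; rewrite d0 !addr0.
Qed.

Lemma delta_act_op a T : delta (Lop a * T) = Lop a * delta T.
Proof.
have [d [hd -> ->]] := hdelta (Lop a * T) T.
by have [_ ->] := hd; rewrite derivation_act_op // mul0r add0r.
Qed.

Lemma delta_sqr T : delta (T * T) = delta T * T + T * delta T.
Proof. by have [d [[_ dM] -> ->]] := hdelta (T * T) T. Qed.

Lemma endA_reduced x y : inner x y * inner x y = 0 :> A -> inner x y = 0 :> A.
Proof. exact: (@sqr_eq0 R (comm_alg hA)). Qed.

(* [p T p] is an [A]-multiple of [p], so [p (delta T) p] depends additively on
   [T]. *)
Lemma delta_theta x y T : let p := theta x y in
  p * delta T * p =
  Lop (inner (T x) y) * delta p - delta p * T * p - p * T * delta p.
Proof.
move=> p; have [d [hd -> ->]] := hdelta T p; have [_ dM] := hd.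
have := congr1 d (theta_sandwich hA x y T).
rewrite -/p !dM derivation_act_op // mul0r add0r => <-.
by nc_ring.
Qed.

Lemma delta_add S T : delta (S + T) = delta S + delta T.
Proof.
pose U := delta (S + T) - delta S - delta T.
suff U0 : U = 0.
  have -> : delta (S + T) = U + (delta S + delta T) by rewrite /U; nc_ring.
  by rewrite U0 add0r.
have pUp x y : theta x y * U * theta x y = 0.
  set p := theta x y.
  have -> : p * U * p =
      p * delta (S + T) * p - p * delta S * p - p * delta T * p.
    by rewrite /U; nc_ring.
  rewrite !delta_theta -/p (_ : (S + T) x = S x + T x) // innerDl act_opD.
  by nc_ring.
apply: endA_inj => x; apply: (@inner_eq0 _ _ M).
(* For [p = theta x (U x)], evaluating [p U p = 0] at [U x] gives [c^2 x = 0]; applying [U] and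
   pairing with [U x] gives [c^3 = 0]. *)
pose c : A := inner (U x) (U x).
have c0 : act (c * c) x = 0.
  have := congr1 (fun T : endA M => T (U x)) (theta_sandwich hA x (U x) U).
  by rewrite pUp /= -actM => <-.
have c3 : c * c * c = 0 by rewrite -inner_actl -endA_act c0 endA0 inner0l.
apply: endA_reduced; apply: (@sqr_eq0 R (comm_alg hA)).
by rewrite -/c; change (c * c * (c * c) = 0); rewrite mulrA c3 mul0r.
Qed.

Lemma delta_mul S T : delta (S * T) = delta S * T + S * delta T.
Proof.
have torsion2 Z : Z + Z = 0 -> Z = 0.
  move=> Z0; apply: endA_inj => z; have := congr1 (fun T : endA M => T z) Z0.
  rewrite /= -mulr2n -scaler_nat => /eqP.
  by rewrite scaler_eq0 pnatr_eq0 /= => /eqP.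
pose G S T := jordan_defect delta S T.
suff G0 : G S T = 0.
  rewrite -[LHS](subrK (delta S * T)) -[_ - _](subrK (S * delta T)).
  by rewrite -/(jordan_defect delta S T) -/(G S T) G0; nc_ring.
set U := G S T; pose C := S * T - T * S.
have endA_addE (V W : endA M) z : (V + W) z = V z + W z by [].
have thetaE (V W : endA M) x y z :
  (V * theta x y * W) z = act (inner (W z) y) (V x) by exact: endA_act.
(* Herstein's identity with [r = theta x y], evaluated at [z]. *)
have cross x y z :
    act (inner (C z) y : A) (U x) + act (inner (U z) y : A) (C x) = 0.
  have := jordan_defect_cross torsion2 delta_add delta_sqr S T (theta x y).
  move/(congr1 (fun T : endA M => T z)).
  by rewrite -/(G S T) -/U -/C endA_addE !thetaE.
have CU x y z : inner (C z) y * inner (U x) y = 0 :> A.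
  apply: (@cross_eq0 R (comm_alg hA) M (fun t => inner (C t) y)
    (fun t => inner (U t) y)) => {x z} x z.
  by have := inner0l y; rewrite -(cross x y z) innerDl !inner_actl.
(* Polarization of [CU] in [y]; [cross_eq0r] then separates the two terms. *)
have CUw x y z w : inner (C z) y * inner (U x) w = 0 :> A.
  apply: (@cross_eq0r R (comm_alg hA) _ (inner (U x) y) (inner (C z) w)) => //.
  have := CU x (y + w) z; rewrite !innerDr mulrDl !mulrDr.
  by rewrite !CU add0r addr0.
have eC x w : Lop (inner (U x) w) * C = 0.
  apply: endA_inj => z; apply: (@inner_eq0 _ _ M).
  rewrite (_ : (_ * C) z = act (inner (U x) w) (C z)) // inner_actl inner_actr.
  by rewrite mulrA [_ * inner (C z) _]hA CUw mul0r.
have eU x w : Lop (inner (U x) w) * U = 0.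
  set e := Lop _.
  (* The defect is [A]-linear in its first argument, and [e S] commutes with [T] because
     [e C = 0]. *)
  have -> : e * U = G (e * S) T.
    rewrite /U /G /jordan_defect -mulrA !delta_act_op -/e.
    by rewrite -!mulrA; nc_ring.
  have eST : e * S * T = T * (e * S).
    rewrite [RHS]mulrA -(act_op_central hA) -/e; apply/subr0_eq.
    by rewrite -(eC x w) -/e /C; nc_ring.
  apply: (jordan_defect_comm torsion2 delta_add delta_sqr) => //.
  (* A single derivation agrees with [delta] at both [e S] and [T], so both sides are its value at
     their product. *)
  have [d [[_ dM] -> ->]] := hdelta (e * S) T.
  by rewrite -!dM eST.
have Uw x w : inner (U x) w = 0 :> A.
  apply: endA_reduced; rewrite -inner_actl.
  by have /(congr1 (fun T : endA M => T x)) /= -> := eU x w; rewrite inner0l.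
by apply: endA_inj => x; apply: (@inner_eq0 _ _ M); exact: Uw.
Qed.
End TwoLocal.

Theorem theorem3p2 (R : realType) (A : cstarAlgType R)
    (hA : commutative (@GRing.mul A))
    (M : hilbertModType A) (hM : full M) (delta : endA M -> endA M)
    (hdelta : is_2local_derivation (@GRing.mul (endA M)) delta) :
  is_derivation (@GRing.mul (endA M)) delta.
Proof.
split=> [k S T|S T]; last exact: delta_mul.
by rewrite (delta_add hA hM hdelta) (delta_scale hdelta).
Qed.
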